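(* For every finite set $M\subset\mathbb R^d$ there exists $n\in\mathbb N$ such that for every coloring of $\mathbb R^n$ (with an arbitrary, possibly infinite, number of colors) there exists a set $M'\subset\mathbb R^n$ which is an $\ell_\infty$-isometric copy of $M$ and which is either monochromatic or rainbow.
   Context: For $\mathbf x=(x_1,\dots,x_n)$, $\|\mathbf x\|_\infty=\max_i|x_i|$. A set $M'\subset\mathbb R^n$ is an $\ell_\infty$-isometric copy of $M\subset\mathbb R^d$ if there is a bijection $f:M\to M'$ with $\|\mathbf x-\mathbf y\|_\infty=\|f(\mathbf x)-f(\mathbf y)\|_\infty$ for all $\mathbf x,\mathbf y\in M$ (distances in $M$ measured by the max-norm on $\mathbb R^d$). A set is monochromatic if all its points have the same color and rainbow if all its points have pairwise distinct colors. *)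

(* Defs.v *)
From HB Require Import structures.
From mathcomp Require Import all_boot all_order all_algebra.
From mathcomp Require Import all_classical all_reals all_analysis.

Set Implicit Arguments.
Unset Strict Implicit.
Unset Printing Implicit Defensive.

Import Order.TTheory GRing.Theory Num.Theory.
Import numFieldNormedType.Exports.

Local Open Scope classical_set_scope.
Local Open Scope ring_scope.

(* The library norm [`|x|] on ['rV[R]_n] is the max-norm ([mx_normrE]), so
   [`|x - y|] is the l_infinity distance on R^n. *)

(* The bijection is represented by a total map R^d -> R^n, of which only the
   values on [M] matter; this is no restriction, as R^n is inhabited. *)
Definition linf_isometric_copy (R : realType) (d n : nat)
    (M : set 'rV[R]_d) (M' : set 'rV[R]_n) : Prop :=
  exists f : 'rV[R]_d -> 'rV[R]_n,
    set_bij M M' f /\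
    (forall x y, M x -> M y -> `|x - y| = `|f x - f y|).

Definition monochromatic (T C : Type) (chi : T -> C) (A : set T) : Prop :=
  forall x y, A x -> A y -> chi x = chi y.

Definition rainbow (T C : Type) (chi : T -> C) (A : set T) : Prop :=
  forall x y, A x -> A y -> x <> y -> chi x <> chi y.

(* Main.v *)
(* Take as letters finitely many 1-Lipschitz maps g of R^d. A word g_1 ... g_N
   gives the l_infinity-isometric embedding z |-> (z, g_1 z, ..., g_N z) of M;
   color it by the equivalence relation that chi induces on M. By Hales-Jewett
   this relation is constant on a combinatorial line. If it is equality, any
   point of the line is a rainbow copy. Otherwise two points x != y of M get the
   same color for every letter put in the active coordinates; as the letters
   take all prescribed values p at x and q at y for close p, q in a fine chain
   joining points of M, the points with z in the active coordinates and the
   other coordinates frozen as for x have the same color for all z in M, and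
   form a copy of M. *)
Require Import Defs.
From HB Require Import structures.
From mathcomp Require Import all_boot all_order all_algebra.
From mathcomp Require Import all_classical all_reals all_analysis.

Import Order.TTheory GRing.Theory Num.Theory.
Import numFieldNormedType.Exports.

Local Open Scope classical_set_scope.
Local Open Scope ring_scope.

(** * The Hales-Jewett theorem *)

(* A combinatorial line is a word over [option A], [None] marking the active
   coordinates. *)
Definition line_point {A J : finType} (w : {ffun J -> option A}) (a : A) :
  {ffun J -> A} := [ffun j => odflt a (w j)].

Definition has_mono_line {A J C : finType} (chi : {ffun J -> A} -> C) : Prop :=
  exists w : {ffun J -> option A}, (exists j, w j = None) /\
    forall a b, chi (line_point w a) = chi (line_point w b).

Definition hales_jewett_for (A : finType) : Prop :=
  forall C : finType, exists J : finType,
    forall chi : {ffun J -> A} -> C, has_mono_line chi.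

Lemma hales_jewett_surj (A B : finType) (g : A -> B) (h : B -> A) :
  cancel h g -> hales_jewett_for A -> hales_jewett_for B.
Proof.
move=> hK HA C; have [J HJ] := HA C; exists J => chi.
have [w [[j wj] wE]] := HJ (fun u => chi [ffun j => g (u j)]).
exists [ffun j => omap g (w j)]; split; first by exists j; rewrite ffunE wj.
suff E b : line_point [ffun j => omap g (w j)] b
           = [ffun j => g (line_point w (h b) j)] by move=> a b; rewrite !E.
by apply/ffunP => i; rewrite !ffunE; case: (w i) => //=; rewrite hK.
Qed.

Definition join_word {A J1 J2 : finType} (u : {ffun J1 -> A})
  (v : {ffun J2 -> A}) : {ffun J1 + J2 -> A} :=
  [ffun j => match j with inl i => u i | inr i => v i end].

Definition map_word {A B J : finType} (g : A -> B) (u : {ffun J -> A}) :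
  {ffun J -> B} := [ffun j => g (u j)].

Lemma line_point_join (A J1 J2 : finType) (w1 : {ffun J1 -> option A})
    (w2 : {ffun J2 -> option A}) a :
  line_point (join_word w1 w2) a
  = join_word (line_point w1 a) (line_point w2 a).
Proof. by apply/ffunP => -[i|i]; rewrite !ffunE. Qed.

Lemma line_point_const (A J : finType) (u : {ffun J -> A}) a :
  line_point (map_word Some u) a = u.
Proof. by apply/ffunP => i; rewrite !ffunE. Qed.

Lemma line_point_map (A B J : finType) (g : A -> B)
    (w : {ffun J -> option A}) a :
  line_point (map_word (omap g) w) (g a) = map_word g (line_point w a).
Proof. by apply/ffunP => j; rewrite !ffunE; case: (w j). Qed.

(* The lines meet at the extra letter [None] of [option B]; on the letters of
   [B] they are monochromatic, and [S] consists of colors they realize. *)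
Definition focused {B J C : finType} (chi : {ffun J -> option B} -> C)
    (f : {ffun J -> option B}) (S : {set C}) : Prop :=
  forall c, c \in S -> exists w : {ffun J -> option (option B)},
    [/\ exists j, w j = None, line_point w None = f
      & forall b, chi (line_point w (Some b)) = c].

Lemma focused_meet (B J C : finType) (chi : {ffun J -> option B} -> C) f S :
  focused chi f S -> chi f \in S -> has_mono_line chi.
Proof.
move=> foc /foc[w [wN wf wB]]; exists w; split => //.
suff E a : chi (line_point w a) = chi f by move=> a b; rewrite !E.
by case: a => [b|]; rewrite ?wB ?wf.
Qed.

(** Induction on [r]. [HB], with the colorings of words over [J] as colors, gives a line [w] on [J']
    whose letters from [B] all induce the same coloring [chi2] on [J]. Lines focused at [f] for
    [chi2] are joined to [w], and [w] joined to the constant word [f] contributes the new color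
    [chi2 f]. *)
Lemma color_focusing (B C : finType) (b0 : B) (r : nat) :
  hales_jewett_for B ->
  exists J : finType, forall chi : {ffun J -> option B} -> C,
    has_mono_line chi \/
    exists f (S : {set C}), (r <= #|S|)%N /\ focused chi f S.
Proof.
move=> HB; elim: r => [|r [J HJ]].
  exists unit => chi; right; exists [ffun=> None], finset.set0.
  by split=> // c; rewrite finset.in_set0.
have [J' HJ'] := HB {ffun {ffun J -> option B} -> C}.
exists (J' + J)%type => chi.
have [w [[j0 wj0] wE]] :=
  HJ' (fun u => [ffun v => chi (join_word (map_word Some u) v)]).
pose w' := map_word (omap Some) w.
have w'N : exists j, w' j = None by exists j0; rewrite ffunE wj0.
pose chi2 v := chi (join_word (line_point w' (Some b0)) v).
have chi2E b v : chi (join_word (line_point w' (Some b)) v) = chi2 v.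
  by have /ffunP/(_ v) := wE b b0; rewrite !ffunE /chi2 !line_point_map.
have chi2_mono : has_mono_line chi2 -> has_mono_line chi.
  move=> [v [[j vj] vE]].
  exists (join_word (map_word Some (line_point w' (Some b0))) v).
  split; first by exists (inr j); rewrite ffunE.
  by move=> a b; rewrite !line_point_join !line_point_const; apply: vE.
have [/chi2_mono|[f [S [rS foc]]]] := HJ chi2; first by left.
have [/(focused_meet _ _ _ _ _ _ foc)/chi2_mono|fS] := boolP (chi2 f \in S).
  by left.
right; exists (join_word (line_point w' None) f), (chi2 f |: S)%SET.
split; first by rewrite cardsU1 fS.
have [j w'j] := w'N.
move=> c /setU1P[->|/foc[v [_ vf vB]]].
  exists (join_word w' (map_word Some f)); split.
  - by exists (inl j); rewrite ffunE.
  - by rewrite line_point_join line_point_const.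
  - by move=> b; rewrite line_point_join line_point_const chi2E.
exists (join_word w' v); split.
- by exists (inl j); rewrite ffunE.
- by rewrite line_point_join vf.
- by move=> b; rewrite line_point_join chi2E vB.
Qed.

(** Once [#|C|] colors are focused, the color of the focus must be one of them. *)
Lemma hales_jewett_option (B : finType) (b0 : B) :
  hales_jewett_for B -> hales_jewett_for (option B).
Proof.
move=> HB C; have [J HJ] := color_focusing B C b0 #|C| HB.
exists J => chi; have [//|[f [S [CS foc]]]] := HJ chi.
apply: (focused_meet _ _ _ _ _ _ foc).
suff -> : S = [set: C]%SET by rewrite finset.in_setT.
by apply/eqP; rewrite eqEcard finset.subsetT cardsT.
Qed.

Lemma hales_jewett (A : finType) (a0 : A) : hales_jewett_for A.
Proof.
have HI n : hales_jewett_for 'I_n.+1.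
  elim: n => [C|n /(hales_jewett_option _ ord0)].
    exists unit => chi; exists [ffun=> None].
    split; first by exists tt; rewrite ffunE.
    by move=> a b; rewrite !ord1.
  apply: (hales_jewett_surj _ _ (oapp (lift ord_max) ord_max) (unlift ord_max)).
  by move=> i; case: unliftP => [j|] ->.
(* The index range has one element too many, which makes it an instance of [HI]; the surplus index
   is sent to [a0]. *)
apply: (hales_jewett_surj _ _ (fun i : 'I_#|A|.+1 => nth a0 (enum A) i)
  (fun a => inord (enum_rank a)) _ (HI _)) => a.
by rewrite inordK ?nth_enum_rank// ltnW// ltnS.
Qed.

(** * Block embeddings *)

Section Blocks.
Context {R : realType} {d : nat} {I : finType}.

(* The extra coordinate, always [0], keeps the dimension positive. *)
Definition block_dim := #|{: option (I * 'I_d)}|.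

Definition blocks (p : I -> 'rV[R]_d) : 'rV[R]_block_dim :=
  \row_k oapp (fun ij => p ij.1 0 ij.2) 0 (enum_val k).

Lemma row_norm_le (n : nat) (u : 'rV[R]_n) (e : R) : 0 <= e ->
  `|u| <= e <-> forall j, `|u 0 j| <= e.
Proof.
move=> e0; rewrite [`|u|]mx_normrE; split.
  by move=> /bigmax_leP[_ H] j; have := H (0, j) isT.
move=> H; apply/bigmax_leP. split => // -[i j] _ /=; rewrite (ord1 i); exact: H.
Qed.

Lemma blocks_dist_le (p q : I -> 'rV[R]_d) (e : R) : 0 <= e ->
  `|blocks p - blocks q| <= e <-> forall i, `|p i - q i| <= e.
Proof.
move=> e0; rewrite row_norm_le//; split=> [H i|H k].
  apply/row_norm_le => // j; have := H (enum_rank (Some (i, j))).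
  by rewrite !mxE enum_rankK.
rewrite !mxE; case: (enum_val k) => [[i j]|] /=; last by rewrite subrr normr0.
by have /(row_norm_le _ _ _ e0)/(_ j) := H i; rewrite !mxE.
Qed.

(** The distance is a maximum over the blocks: none exceeds [|x - y|], and block [i0] attains it. *)
Lemma blocks_isometric_copy (M : set 'rV[R]_d) (h : I -> 'rV[R]_d -> 'rV[R]_d)
    (i0 : I) :
  (forall i x y, `|h i x - h i y| <= `|x - y|) ->
  (forall x y, `|h i0 x - h i0 y| = `|x - y|) ->
  linf_isometric_copy M ((fun x => blocks (h ^~ x)) @` M).
Proof.
move=> hlip hi0; exists (fun x => blocks (h ^~ x)).
have iso x y : `|x - y| = `|blocks (h ^~ x) - blocks (h ^~ y)|.
  apply/eqP; rewrite eq_le; apply/andP; split; last first.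
    by apply/blocks_dist_le => // i; apply: hlip.
  by rewrite -hi0; move: i0 {hi0}; apply/(blocks_dist_le (h ^~ x) (h ^~ y)).
split=> //; apply: inj_bij => x y _ _ xy.
by apply/eqP; rewrite -subr_eq0 -normr_eq0 iso xy subrr normr0.
Qed.

End Blocks.

(** * Lipschitz maps with prescribed values at two points *)

Section Steps.
Context {R : realType} {d : nat}.
Implicit Types x y p v z : 'rV[R]_d.

Definition step x y p v z := p + (`|z - x| / `|y - x|) *: v.

Lemma step_source x y p v : step x y p v x = p.
Proof. by rewrite /step subrr normr0 mul0r scale0r addr0. Qed.

Lemma step_target x y p v : x != y -> step x y p v y = p + v.
Proof.
move=> xy; rewrite /step divff ?scale1r// normr_eq0 subr_eq0 eq_sym//.
Qed.

(** The variable enters only through its distance to [x], which is 1-Lipschitz, and the slope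
    [|v| / |y - x|] is at most 1. For [x = y] division by zero makes the map constant. *)
Lemma step_lipschitz x y p v z t : (x != y -> `|v| <= `|y - x|) ->
  `|step x y p v z - step x y p v t| <= `|z - t|.
Proof.
move=> vxy; rewrite /step opprD addrACA subrr add0r -scalerBl -mulrBl.
rewrite normrZ normrM normfV normr_id -mulrA.
have -> : z - t = (z - x) - (t - x) by rewrite opprB addrA subrK.
apply: le_trans (ler_dist_dist _ _); rewrite ler_piMr//.
have [->|xy] := eqVneq x y; first by rewrite subrr normr0 invr0 mul0r ler01.
have yx_gt0 : 0 < `|y - x| by rewrite normr_gt0 subr_eq0 eq_sym.
by rewrite mulrC ler_pdivrMr ?mul1r//; exact: vxy.
Qed.

End Steps.

Lemma fine_subdivision {R : realType} {d : nat} (s : seq 'rV[R]_d) :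
  exists K : nat, forall x y a b, x \in s -> y \in s -> a \in s -> b \in s ->
    x != y -> `|K.+1%:R^-1 *: (b - a)| <= `|y - x|.
Proof.
pose q (t : seq_sub s * seq_sub s * (seq_sub s * seq_sub s)) : R :=
  `|val t.2.2 - val t.2.1| / `|val t.1.2 - val t.1.1|.
(* A common archimedean bound for the finitely many ratios. *)
exists (\max_t Num.bound (q t)) => x y a b xs ys as_ bs xy.
set K := \max_t _.
have yx_gt0 : 0 < `|y - x| by rewrite normr_gt0 subr_eq0 eq_sym.
pose t := ((SeqSub xs, SeqSub ys), (SeqSub as_, SeqSub bs)).
have qK : q t <= K.+1%:R.
  apply: (le_trans (ltW (archi_boundP _))); first by rewrite divr_ge0.
  by rewrite ler_nat leqW// /K (bigD1 t)//= leq_maxl.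
rewrite normrZ normfV ger0_norm// mulrC ler_pdivrMr ?ltr0Sn//.
by move: qK; rewrite /q /= ler_pdivrMr// mulrC.
Qed.

Theorem theorem5 (R : realType) (d : nat) (M : set 'rV[R]_d)
    (finM : finite_set M) :
  exists n : nat, (0 < n)%N /\
    forall (C : Type) (chi : 'rV[R]_n -> C),
      exists M' : set 'rV[R]_n,
        linf_isometric_copy M M' /\
        (monochromatic chi M' \/ rainbow chi M').
Proof.
have [M0|/set0P[x0]] := eqVneq M set0.
  exists 1%N; split=> // C chi; exists set0; split; last by left.
  by rewrite M0; exists (fun=> 0); split=> //; split=> // x; rewrite inE.
have /finite_seqP[s {finM}Ms] := finM; rewrite {}Ms {M} /= => x0s.
have [K HK] := fine_subdivision s.
pose pt (a b : 'rV[R]_d) (k : nat) := a + (k%:R / K.+1%:R) *: (b - a).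
pose X : finType := seq_sub s.
(* A letter names a pair [x], [y], a chain from [a] to [b] and a position [k] on it. Its map either
   takes [pt a b k] at [x] to [pt a b k.+1] at [y], or is constantly [pt a b k.+1]. *)
pose L : finType := (X * X * (X * X) * 'I_K.+1 * bool)%type.
pose G (l : L) : 'rV[R]_d -> 'rV[R]_d :=
  let: (x, y, (a, b), k, moving) := l in
  if moving then step (val x) (val y) (pt (val a) (val b) k)
                      (K.+1%:R^-1 *: (val b - val a))
  else fun=> pt (val a) (val b) k.+1.
have Glip l z t : `|G l z - G l t| <= `|z - t|.
  case: l => -[[[[x xs] [y ys]] [[a as_] [b bs]]] k] [] /=.
    by apply: step_lipschitz; apply: HK.
  by rewrite subrr normr0.
pose l0 : L :=
  let x := SeqSub x0s in (x, x, (x, x), ord0, true).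
have [J HJ] := hales_jewett L l0 {ffun X * X -> bool}.
exists (@block_dim d (option J)); split; first by rewrite /block_dim card_option.
move=> C chi.
(* The identity in block [None] makes every word an isometric embedding. *)
pose letters (u : {ffun J -> L}) (j : option J) : 'rV[R]_d -> 'rV[R]_d :=
  if j is Some i then G (u i) else id.
pose F u z := blocks (letters u ^~ z).
have [w [[j0 wj0] wE]] := HJ (fun u => [ffun xy : X * X =>
  `[< chi (F u (val xy.1)) = chi (F u (val xy.2)) >]]).
have [[x [y [xy chixy]]]|norep] := pselect (exists x y : X, val x != val y /\
    chi (F (line_point w l0) (val x)) = chi (F (line_point w l0) (val y)));
  last first.
  exists (F (line_point w l0) @` [set` s]); split.
    by apply: (blocks_isometric_copy _ _ None) => // -[i|]//; exact: Glip.
  right=> _ _ [x xs <-] [y ys <-] Fxy chixy; apply: norep.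
  exists (SeqSub xs), (SeqSub ys); split=> //=.
  by apply: contra_notN Fxy => /eqP ->.
have {}chixy l :
    chi (F (line_point w l) (val x)) = chi (F (line_point w l) (val y)).
  have /ffunP/(_ (x, y)) := wE l0 l; rewrite !ffunE /=.
  by move=> H; apply/asboolP; rewrite -H; apply/asboolP.
(* Frozen blocks are evaluated at [z]; active blocks hold the free point [p]. *)
pose fiber z (j : option J) (p : 'rV[R]_d) : 'rV[R]_d :=
  if j is Some i then if w i is Some l then G l z else p else z.
have FE l z : F (line_point w l) z = blocks (fiber z ^~ (G l z)).
  congr blocks; apply/funext => -[i|//] /=.
  by rewrite ffunE; case: (w i).
pose xi p := chi (blocks (fiber (val x) ^~ p)).
(* The fiber over [x] and the fiber over [y] give equal colors to the points at
   distance at most [`|x - y|], so that two neighbours in the fiber over [x]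
   share the color of one point in the fiber over [y]. *)
have xi_pt (a b : X) k : (k < K.+1)%N ->
    xi (pt (val a) (val b) k) = xi (pt (val a) (val b) k.+1).
  move=> kK; pose l m : L := (x, y, (a, b), Ordinal kK, m).
  have := chixy (l true); rewrite !FE /= step_source step_target//.
  have -> : pt (val a) (val b) k + K.+1%:R^-1 *: (val b - val a)
            = pt (val a) (val b) k.+1.
    by rewrite /pt -addrA -scalerDl -[in RHS]natr1 mulrDl mul1r.
  (* The constant letter returns from the fiber over [y] to the fiber over [x] without changing the
     point. *)
  by have := chixy (l false); rewrite !FE /= /xi => -> ->.
have xi_cst (a b : X) : xi (val a) = xi (val b).
  have path k : (k <= K.+1)%N -> xi (pt (val a) (val b) k) = xi (val a).
    elim: k => [_|k IH kK]; first by rewrite /pt mul0r scale0r addr0.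
    by rewrite -xi_pt// IH// ltnW.
  by rewrite -(path K.+1)// /pt divff ?pnatr_eq0// scale1r addrC subrK.
exists ((fun p => blocks (fiber (val x) ^~ p)) @` [set` s]); split.
  (* The active block [j0] holds [p] itself. *)
  apply: (blocks_isometric_copy _ _ (Some j0)).
  - move=> [i|] p q /=; last by rewrite subrr normr0.
    by case: (w i) => [l|//]; rewrite subrr normr0.
  - by move=> p q; rewrite /fiber wj0.
by left=> _ _ [a as_ <-] [b bs <-]; apply: (xi_cst (SeqSub as_) (SeqSub bs)).
Qed.
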